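(* Let $a$ be a positive integer, let $b \in \mathbb{Z}^+ \cup \{\infty\}$, and let $f : \mathbb{Z}^+ \to \mathbb{N}$ be a monotone increasing function with $f(n) \to \infty$ as $n \to \infty$. Then there exist infinite sets $A = \{a_1 < a_2 < \cdots\}$ and $B = \{b_1 < b_2 < \cdots\}$ of nonnegative integers such that $s_A = a$, $s_B = b$ and $|a_n - b_n| \le f(n)$ for every $n \ge 1$. The last inequality implies that $d_{A,B}(n-1) \le f(n)$ for every $n\ge 1$.
   Context: $\mathbb{N}$ denotes the set of nonnegative integers and $\mathbb{Z}^+$ the set of positive integers; ''monotone increasing'' means nondecreasing. For infinite sets $A = \{a_1 < a_2 < \cdots\}$, $B = \{b_1 < b_2 < \cdots\}$ of nonnegative integers, enumerated increasingly: $R_A(n)$ is the number of pairs $(i,j)$ with $i \le j$ and $a_i + a_j = n$; $s_A(x) = \max_{n \le x} R_A(n)$ and $s_A = \lim_{x\to\infty} s_A(x) \in \mathbb{N}\cup\{\infty\}$ (similarly for $B$); $d_{A,B}(x) = \max\{|a_t - b_t| : a_t \le x \text{ or } b_t \le x\}$, where the maximum over the empty set is taken to be $0$. *)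

(* Defs.v *)
From mathcomp Require Import all_boot all_order all_algebra finmap.
From mathcomp Require Import all_classical topology.

Set Implicit Arguments.
Unset Strict Implicit.
Unset Printing Implicit Defensive.

Local Open Scope classical_set_scope.
Local Open Scope nat_scope.

(* Indices start at 1: [u t] is the t-th smallest element of [A] for [0 < t],
   and [u 0] is a junk value that none of the definitions below read. *)
Definition increasing_enum (A : set nat) (u : nat -> nat) : Prop :=
  (forall i j, 0 < i -> i < j -> u i < u j) /\ u @` [set i | 0 < i] = A.

(* [fset_set] sends infinite sets to the empty set. The set of pairs here, and
   the index set in [enum_dist], are finite because [u] and [v] are strictly
   increasing on positive indices. *)
Definition repr_count (u : nat -> nat) (n : nat) : nat :=
  #|` fset_set [set p : nat * nat | 0 < p.1 /\ p.1 <= p.2 /\ u p.1 + u p.2 = n]|.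

Definition repr_max (u : nat -> nat) (x : nat) : nat :=
  \max_(n < x.+1) repr_count u n.

Variant natbar := Nfin of nat | Ninfty.

(* The topology of [nat] is discrete; [\oo] as a target is divergence to
   infinity. *)
Definition cvg_natbar (w : nat -> nat) (l : natbar) : Prop :=
  match l with
  | Nfin k => w x @[x --> \oo] --> k
  | Ninfty => w x @[x --> \oo] --> \oo
  end.

Definition repr_lim (u : nat -> nat) (l : natbar) : Prop :=
  cvg_natbar (repr_max u) l.

Definition enum_dist (u v : nat -> nat) (x : nat) : nat :=
  \max_(t <- fset_set [set t | 0 < t /\ (u t <= x \/ v t <= x)]) `|u t - v t|.

(* Main.v *)
Require Import Defs.
From mathcomp Require Import all_boot all_order all_algebra finmap.
From mathcomp Require Import all_classical topology.
From mathcomp Require Import zify.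

(** Both sequences are built from the same blocks of consecutive indices. Number
    the indices from 0. A block that starts at index n and has 2m elements
    begins with the low terms 8^n, ..., 8^(n+m-1); with L = n + 2m - 1 its last
    index, it continues with the high terms 8^L - 8^t + e_(t-n) for
    t = n+m-1, ..., n. The low term 8^t and the high term that mirrors it have
    sum 8^L + e_(t-n), so that e alone decides how many of the m mirror pairs
    share a sum. For the target value c, take e_i = i + 1 - c truncated at 0, or
    e = 0 when c is infinite: min(c, m) mirror pairs then have sum 8^L, and the
    sums of the others are pairwise distinct.

    No other coincidences occur, which is [sum_rigid]. The terms are so
    spread out that the size of a sum determines the exponent of its largest
    summand; two equal sums therefore involve the same largest term, or high
    terms of one block. In the second case, cancelling 8^L leaves an equation
    between two sums of two numbers that are nearly powers of 8, and comparing
    sizes again gives either the same pair or two mirror pairs with the same e.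
    Hence every sum has at most c representations ([repr_count_le]), and a block
    of length m >= c reaches c ([repr_count_ge]).

    The two sequences for a and b differ only at high terms, and there by at
    most m - 1. Taking m - 1 to be the smaller of f (n+1) and n makes this at
    most f at every index of the block, by monotonicity, keeps e small compared
    with the least power 8^n of the block, and still lets m tend to infinity. *)
Set Implicit Arguments.
Unset Strict Implicit.
Unset Printing Implicit Defensive.

Local Open Scope classical_set_scope.
Local Open Scope nat_scope.

(** * Magnitudes of powers of 8 *)

Lemma exp8_gt0 k : 0 < 8 ^ k. Proof. by rewrite expn_gt0. Qed.

Lemma exp8_lt i j : i < j -> 8 * 8 ^ i <= 8 ^ j.
Proof. by move=> lt_ij; rewrite -expnS leq_exp2l. Qed.

Lemma exp8_linear i k : i <= k -> 8 * i <= 8 ^ k.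
Proof.
move=> le_ik; apply: leq_trans (_ : 8 * k <= _); first by rewrite leq_mul2l.
elim: k {le_ik} => [|k IHk] //; have := exp8_gt0 k; rewrite expnS; lia.
Qed.

(** The intervals [7/8 * 8^i, 2 * 8^i] are pairwise disjoint. The slack of 1/8
    below absorbs the smaller powers of 8 subtracted in high terms and the noise
    [e]; the factor 2 above leaves room for a second summand. *)
Lemma exp8_scale_inj i j x :
    7 * 8 ^ i <= 8 * x -> x <= 2 * 8 ^ i ->
    7 * 8 ^ j <= 8 * x -> x <= 2 * 8 ^ j ->
  i = j.
Proof.
have := exp8_gt0 i; have := exp8_gt0 j.
case: (ltngtP i j) => [/exp8_lt|/exp8_lt|//]; lia.
Qed.

(** * The block sequence and its sums *)

Section Sequence.

Variables (len e : nat -> nat).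
Hypothesis len_gt0 : forall n, 0 < len n.
Hypothesis len_le : forall n, len n <= n.+1.
Hypothesis e_le : forall i, e i <= i.

Fixpoint block_start j :=
  if j is i.+1 then
    let n := block_start i in if i.+1 == n + 2 * len n then i.+1 else n
  else 0.

Definition low j := j < block_start j + len (block_start j).

(** Reflection in the centre of the block; only used to send high indices to
    low ones. *)
Definition mirror j := (2 * (block_start j + len (block_start j))).-1 - j.

(** The exponent of the power of 8 to which [term j] is close: all the high
    indices of a block share the last index of the block as their level. *)
Definition level j :=
  if low j then j else (block_start j + 2 * len (block_start j)).-1.

Definition term j :=
  if low j then 8 ^ j
  else 8 ^ level j + e (mirror j - block_start j) - 8 ^ mirror j.

Lemma block_start_bounds j :
  block_start j <= j < block_start j + 2 * len (block_start j).
Proof.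
elim: j => [|j IHj] /=; first by have := len_gt0 0; lia.
by case: eqP => [_|]; [have := len_gt0 j.+1|]; lia.
Qed.

Lemma block_start_cases i j : i <= j ->
  block_start i = block_start j \/
  block_start i + 2 * len (block_start i) <= block_start j.
Proof.
elim: j => [|j IHj]; first by rewrite leqn0 => /eqP ->; left.
rewrite leq_eqVlt => /predU1P[->|/IHj]; first by left.
rewrite /=; have := block_start_bounds j; have := block_start_bounds i.
case: eqP => [?|_ _ _ //].
move=> bi bj [eq_ij|]; last lia.
by right; rewrite eq_ij; lia.
Qed.

Lemma block_start_eq i j :
    block_start j <= i < block_start j + 2 * len (block_start j) ->
  block_start i = block_start j.
Proof.
have := block_start_bounds i; have := block_start_bounds j.
by case: (leqP i j) => [/block_start_cases|/ltnW/block_start_cases] []; lia.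
Qed.

(** Blocks start arbitrarily far out: the block after that of [j] starts
    beyond [j]. *)
Lemma exists_block_start j : exists2 n, j < n & block_start n = n.
Proof.
have := block_start_bounds j.
set n := block_start j + _ => /andP[_ lt_jn]; exists n => //.
have n_gt0 : 0 < n by lia.
have := block_start_bounds n.-1; have : j <= n.-1 by lia.
move=> /block_start_cases [eq_j|]; last by rewrite -/n; lia.
by rewrite -(prednK n_gt0) /= -eq_j prednK // eqxx.
Qed.

Lemma mirror_bounds j : ~~ low j ->
  block_start j <= mirror j < block_start j + len (block_start j).
Proof. by have := block_start_bounds j; rewrite /low /mirror; lia. Qed.

Lemma e_small n i : i < len n -> 8 * e i <= 8 ^ n.
Proof.
by move=> lt_i; apply: exp8_linear; have := e_le i; have := len_le n; lia.
Qed.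

(** The noise is negligible even against the smallest power of the block, and
    not merely against the power it accompanies. Cancelling a term against its
    mirror leaves the noise next to any other power of the block, so the weaker
    bound would not exclude accidental coincidences. *)
Lemma mirror_e_small j : ~~ low j ->
  8 * e (mirror j - block_start j) <= 8 ^ block_start j <= 8 ^ mirror j.
Proof.
move=> /mirror_bounds bm; rewrite leq_exp2l //.
by rewrite e_small /=; lia.
Qed.

Lemma mirror_level j : ~~ low j -> 8 * 8 ^ mirror j <= 8 ^ level j.
Proof.
move=> hj; apply: exp8_lt; move: (mirror_bounds hj); rewrite /level (negPf hj).
by have := len_gt0 (block_start j); lia.
Qed.

Lemma term_low j : low j -> term j = 8 ^ j.
Proof. by rewrite /term => ->. Qed.

(** Stated as a sum, to be free of truncated subtraction. *)
Lemma term_high j : ~~ low j ->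
  term j + 8 ^ mirror j = 8 ^ level j + e (mirror j - block_start j).
Proof.
move=> hj; have := mirror_level hj; rewrite /term (negPf hj).
by have := exp8_gt0 (mirror j); lia.
Qed.

Lemma term_scale j : (7 * 8 ^ level j <= 8 * term j) && (term j <= 8 ^ level j).
Proof.
case: (boolP (low j)) => hj.
  by rewrite /level hj term_low // leqnn andbT leq_mul2r orbT.
have := term_high hj; have := mirror_level hj; have := mirror_e_small hj; lia.
Qed.

Lemma level_lt_or_mirror i j : i < j ->
  level i < level j \/
  [/\ ~~ low i, ~~ low j, block_start i = block_start j & mirror j < mirror i].
Proof.
move=> lt_ij; have bi := block_start_bounds i; have bj := block_start_bounds j.
case: (block_start_cases (ltnW lt_ij)) => [eq_ij|sep]; last first.
  by left; have := len_gt0 (block_start j); rewrite /level;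
     case: (boolP (low i)); case: (boolP (low j)); lia.
rewrite eq_ij in bi; rewrite /level /mirror eq_ij.
case: (boolP (low i)); case: (boolP (low j)); rewrite /low eq_ij => hj hi.
- by left.
- by left; lia.
- by lia.
- by right; split=> //; lia.
Qed.

Lemma term_lt i j : i < j -> term i < term j.
Proof.
move=> /level_lt_or_mirror[lt_l|[hi hj eq_s lt_m]].
  have := exp8_lt lt_l; have := exp8_gt0 (level i).
  by have := term_scale i; have := term_scale j; lia.
have eq_l : level i = level j by rewrite /level (negPf hi) (negPf hj) eq_s.
have := term_high hi; have := term_high hj; rewrite eq_l.
have := mirror_e_small hi; have := mirror_e_small hj; have := exp8_lt lt_m.
by have := exp8_gt0 (mirror j); lia.
Qed.

Lemma term_inj : injective term.
Proof. by move=> i j; case: (ltngtP i j) => [/term_lt|/term_lt|//]; lia. Qed.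

Lemma level_mono i j : i <= j -> level i <= level j.
Proof.
rewrite leq_eqVlt => /predU1P[->//|/level_lt_or_mirror[/ltnW//|[hi hj eq_s _]]].
by rewrite /level (negPf hi) (negPf hj) eq_s.
Qed.

Lemma level_eq i j : level i = level j ->
  i = j \/ [/\ ~~ low i, ~~ low j & block_start i = block_start j].
Proof.
move=> eq_l; case: (ltngtP i j); last by left.
- by case/level_lt_or_mirror=> [|[? ? ? _]]; [lia|right].
- by case/level_lt_or_mirror=> [|[? ? ? _]]; [lia|right].
Qed.

(** Below the high terms of the block of [j], a term is either an exact power
    of 8 of that block or smaller than all of those. *)
Lemma level_low i j : level i < level j -> block_start j <= level i ->
  [/\ low i, level i = i & term i = 8 ^ i].
Proof.
move=> lt_l le_n; suff li : low i by rewrite term_low // {1}/level li.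
have lt_ij : i < j by rewrite ltnNge; apply/negP => /level_mono; lia.
apply/negPn/negP => hi; have := block_start_cases (ltnW lt_ij).
have := block_start_bounds i; have := len_gt0 (block_start i).
move: lt_l le_n; rewrite /level (negPf hi) => lt_l le_n bl bi [eq_s|]; last lia.
move: lt_l; rewrite eq_s; case: (boolP (low j)); last lia.
by move: hi; rewrite /low eq_s; lia.
Qed.

Lemma mirror_inj i j : ~~ low i -> ~~ low j ->
  block_start i = block_start j -> mirror i = mirror j -> i = j.
Proof.
move=> hi hj eq_s; have := block_start_bounds i; have := block_start_bounds j.
by move: hi hj; rewrite /mirror /low eq_s; lia.
Qed.

(** Once [i] mirrors [j], cancelling the two powers of 8 leaves
    [term i' = 8 ^ mirror j' + noise]; the noise is too small to change the
    magnitude, so [i'] mirrors [j'], and then the two noises coincide. *)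
Lemma mirror_matches i j i' j' :
    ~~ low j -> ~~ low j' -> block_start j = block_start j' ->
    level i < level j -> level i' < level j' ->
    term i + term j = term i' + term j' ->
    level i = mirror j ->
  [/\ i = mirror j, i' = mirror j'
    & e (i - block_start j) = e (i' - block_start j')].
Proof.
move=> hj hj' eq_s lt_i lt_i' eq_sum eq_i.
have eq_l : level j = level j' by rewrite /level (negPf hj) (negPf hj') eq_s.
have [_ li ti] : [/\ low i, level i = i & term i = 8 ^ i].
  by apply: (level_low lt_i); rewrite eq_i; case/andP: (mirror_bounds hj).
have im : i = mirror j by rewrite -li.
have := term_high hj; have := term_high hj'.
rewrite eq_l -im -ti eq_s => Tj' Tj.
have := mirror_e_small hj; have := mirror_e_small hj'; rewrite -im eq_s -ti.
move=> Ej' Ej.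
have eq_i' : level i' = mirror j'.
  by apply: (@exp8_scale_inj _ _ (term i')); have := term_scale i'; lia.
have [_ li' ti'] : [/\ low i', level i' = i' & term i' = 8 ^ i'].
  by apply: (level_low lt_i'); rewrite eq_i'; case/andP: (mirror_bounds hj').
have im' : i' = mirror j' by rewrite -li'.
by split=> //; move: Tj' Ej'; rewrite -im' -ti'; lia.
Qed.

(** The heart of the argument: two pairs with the same sum are equal unless both
    are mirror pairs of one block with the same noise. *)
Lemma sum_rigid i j i' j' : i <= j -> i' <= j' ->
    term i + term j = term i' + term j' ->
  (i = i' /\ j = j') \/
  [/\ ~~ low j, ~~ low j' & block_start j = block_start j'] /\
  [/\ i = mirror j, i' = mirror j'
    & e (i - block_start j) = e (i' - block_start j')].
Proof.
move=> le_ij le_ij' eq_sum.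
have from_j : j = j' -> i = i' /\ j = j'.
  by move=> eq_j; split=> //; apply: term_inj; move: eq_sum; rewrite eq_j; lia.
have from_i : i = i' -> i = i' /\ j = j'.
  by move=> eq_i; split=> //; apply: term_inj; move: eq_sum; rewrite eq_i; lia.
have le_l := level_mono le_ij; have le_l' := level_mono le_ij'.
have term_le (k l : nat) : k <= l -> term k <= term l.
  by rewrite leq_eqVlt => /predU1P[->//|/term_lt/ltnW].
(* The larger summand dominates, so the sum determines its level. *)
have eq_l : level j = level j'.
  apply: (@exp8_scale_inj _ _ (term i + term j)); have := term_scale j;
  have := term_scale j'; have := term_le _ _ le_ij; have := term_le _ _ le_ij';
  lia.
have [|[hj hj' eq_s]] := level_eq eq_l; first by left; apply: from_j.
have Sj := term_scale j; have Sj' := term_scale j'.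
have Si := term_scale i; have Si' := term_scale i'.
have Tj := term_high hj; have Tj' := term_high hj'.
have Ej := mirror_e_small hj; have Ej' := mirror_e_small hj'.
have pos := exp8_gt0 (level j).
rewrite -eq_l in le_l' Sj' Tj'.
(* With L the common level, the sum is close to 2 * 8^L when the smaller summand
   is high as well, and at most 9/8 * 8^L otherwise. *)
move: le_l le_l'; rewrite leq_eqVlt => /predU1P[eq_i|lt_i];
  rewrite leq_eqVlt => /predU1P[eq_i'|lt_i'].
- left; apply: from_i.
  have [hi si] : ~~ low i /\ block_start i = block_start j.
    by case: (level_eq eq_i) => [->|[]].
  have [hi' si'] : ~~ low i' /\ block_start i' = block_start j'.
    by case: (level_eq (etrans eq_i' eq_l)) => [->|[]].
  apply: mirror_inj => //; first by rewrite si si'.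
  (* Four high terms: their deficits from 8^L are nearly powers of 8, and the
     deficit of the smaller summand dominates. *)
  have Ti := term_high hi; have Ti' := term_high hi'.
  have Ei := mirror_e_small hi; have Ei' := mirror_e_small hi'.
  rewrite eq_i in Ti; rewrite eq_i' in Ti'.
  have mij : 8 ^ mirror j <= 8 ^ mirror i.
    by rewrite leq_exp2l // /mirror si; lia.
  have mij' : 8 ^ mirror j' <= 8 ^ mirror i'.
    by rewrite leq_exp2l // /mirror si'; lia.
  by apply: (@exp8_scale_inj _ _ (2 * 8 ^ level j - (term i + term j))); lia.
- by have := exp8_lt lt_i'; rewrite eq_i in Si; lia.
- by have := exp8_lt lt_i; rewrite eq_i' in Si'; lia.
(* After cancelling 8^L, the equation equates the sum of [term i] and the
   deficit of [j'] with the sum of [term i'] and the deficit of [j]. The dominant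
   exponents of the two sides agree; the four cases below are the possible
   origins of this exponent. *)
have eq_max : maxn (level i) (mirror j') = maxn (level i') (mirror j).
  have expM p q : 8 ^ maxn p q = maxn (8 ^ p) (8 ^ q).
    by case: (leqP p q) => [le|/ltnW le];
      have := le; rewrite -(leq_exp2l _ _ (isT : 1 < 8)); lia.
  apply: (@exp8_scale_inj _ _ (term i + (8 ^ level j - term j')));
    rewrite expM; lia.
have [nj _] := andP (mirror_bounds hj).
have [nj' _] := andP (mirror_bounds hj').
case: (leqP (mirror j') (level i)) => m1;
  case: (leqP (mirror j) (level i')) => m2.
- left; apply: from_i; have eq_ii : level i = level i' by lia.
  have [_ li _] : [/\ low i, level i = i & term i = 8 ^ i].
    by apply: (level_low lt_i); lia.
  have [_ li' _] : [/\ low i', level i' = i' & term i' = 8 ^ i'].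
    by apply: (level_low lt_i'); lia.
  by rewrite -li -li'.
- right; split=> //; rewrite eq_l in lt_i'; apply: mirror_matches => //; lia.
- right; split=> //; rewrite eq_l in lt_i'.
  suff [-> -> ->] : [/\ i' = mirror j', i = mirror j
    & e (i' - block_start j') = e (i - block_start j)] by [].
  by apply: mirror_matches => //; lia.
- by left; apply: from_j; apply: mirror_inj => //; lia.
Qed.

Lemma matched_pair n t : block_start n = n -> t < len n ->
  let j := (2 * (n + len n)).-1 - (n + t) in
  [/\ n + t < j, ~~ low j, block_start j = n & mirror j = n + t].
Proof.
move=> nE lt_t j; have sj : block_start j = n.
  by rewrite -[RHS]nE; apply: block_start_eq; rewrite nE /j; lia.
by rewrite /mirror /low sj /j; split=> //; lia.
Qed.

Lemma sum_matched n t : block_start n = n -> t < len n -> e t = 0 ->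
  term (n + t) + term ((2 * (n + len n)).-1 - (n + t)) =
  8 ^ (n + 2 * len n).-1.
Proof.
move=> nE lt_t et0; have [_ hj sj mj] := matched_pair nE lt_t.
have lt : low (n + t).
  have si : block_start (n + t) = n.
    by rewrite -[RHS]nE; apply: block_start_eq; rewrite nE; lia.
  by rewrite /low si; lia.
have := term_high hj; rewrite mj sj addKn et0 (term_low lt).
by rewrite /level (negPf hj) sj; lia.
Qed.

End Sequence.

(** * Counting representations *)

Lemma enum_ge u : (forall i j, 0 < i -> i < j -> u i < u j) ->
  forall t, t <= (u t).+1.
Proof.
move=> u_lt; elim=> [//|[//|t] IHt].
by have := u_lt t.+1 t.+2 isT (ltnSn _); lia.
Qed.

Lemma finite_repr u s : (forall i j, 0 < i -> i < j -> u i < u j) ->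
  finite_set [set p : nat * nat | 0 < p.1 /\ p.1 <= p.2 /\ u p.1 + u p.2 = s].
Proof.
move=> u_lt; apply: (@sub_finite_set _ _ (`I_s.+2 `*` `I_s.+2)).
  move=> [i j] /= [_ [_ <-]].
  by have := enum_ge u_lt i; have := enum_ge u_lt j; split => /=; lia.
by apply: finite_setX; apply: finite_II.
Qed.

Lemma card_fset_set_le (T : choiceType) (S : set T) (s : seq T) :
  finite_set S -> (forall x, S x -> x \in s) -> #|` fset_set S| <= size s.
Proof.
move=> finS subS; apply: uniq_leq_size (fset_uniq _) _ => x.
by rewrite in_fset_set // inE => /subS.
Qed.

Lemma card_fset_set_ge (T : choiceType) (S : set T) (s : seq T) :
    finite_set S -> uniq s -> (forall x, x \in s -> S x) ->
  size s <= #|` fset_set S|.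
Proof.
move=> finS s_uniq subS; apply: uniq_leq_size => // x /subS Sx.
by rewrite in_fset_set // inE.
Qed.

(** A term with index beyond [n] is at least [n] because the terms are distinct
    nonnegative integers; so only indices up to [n] enter the distance at
    [n.-1], and there [f] is at most [f n]. *)
Lemma enum_dist_le u v f :
    (forall i j, 0 < i -> i < j -> u i < u j) ->
    (forall i j, 0 < i -> i < j -> v i < v j) ->
    (forall m n, 0 < m -> m <= n -> f m <= f n) ->
    (forall n, 0 < n -> `|u n - v n| <= f n) ->
  forall n, 0 < n -> enum_dist u v n.-1 <= f n.
Proof.
move=> u_lt v_lt f_mono uv_le n n_gt0; rewrite /enum_dist.
have bound t : u t <= n.-1 \/ v t <= n.-1 -> t <= n.
  by have := enum_ge u_lt t; have := enum_ge v_lt t; lia.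
apply/bigmax_leqP_seq => t + _; rewrite in_fset_set; last first.
  apply: (@sub_finite_set _ _ `I_n.+1); last exact: finite_II.
  by move=> t' /= [_ /bound]; rewrite ltnS.
rewrite inE => -[t_gt0 /bound le_tn].
by apply: leq_trans (uv_le t t_gt0) _; apply: f_mono.
Qed.

(** * Prescribing the number of representations *)

(** For finite [k > 0] the noise vanishes on the first [k] offsets and is injective
    on the others, so exactly [k] mirror pairs of a long block share a sum. For
    an infinite target all of them do. *)
Definition shift (c : natbar) i := if c is Nfin k then i.+1 - k else 0.

Lemma shift_le c i : c <> Nfin 0 -> shift c i <= i.
Proof. by case: c => [[|k]|] //= _; lia. Qed.

Section Representations.

Variables (len : nat -> nat) (c : natbar).
Hypothesis len_gt0 : forall n, 0 < len n.
Hypothesis len_le : forall n, len n <= n.+1.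
Hypothesis c_neq0 : c <> Nfin 0.

Let e_le i : shift c i <= i := shift_le i c_neq0.

Definition enum_term t := term len (shift c) t.-1.

Lemma enum_term_lt i j : 0 < i -> i < j -> enum_term i < enum_term j.
Proof. by move=> i_gt0 lt_ij; apply: term_lt => //; lia. Qed.

(** A mirror pair in the indexing from 1 used by [enum_term]. *)
Definition matched n t := ((n + t).+1, ((2 * (n + len n)).-1 - (n + t)).+1).

(** Fix one representation. If it is a mirror pair without noise, all others are
    mirror pairs without noise of the same block, and there are at most [k] of
    these. Otherwise it is the only one, because equal positive noises
    come from equal offsets. *)
Lemma repr_count_le k s : c = Nfin k -> repr_count enum_term s <= k.
Proof.
move=> cE; have k_gt0 : 0 < k by case: k cE c_neq0 => // -> [].
have finS := finite_repr s enum_term_lt; rewrite /repr_count.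
have [[[[|i] [|j]] /= [] // _ [] // le_ij eq_s]|noS] :=
  pselect (exists p : nat * nat,
    0 < p.1 /\ p.1 <= p.2 /\ enum_term p.1 + enum_term p.2 = s); last first.
  apply: leq_trans (_ : 0 <= _) => //.
  by apply: (@card_fset_set_le _ _ [::]) => // p Sp; case: noS; exists p.
have rigid := sum_rigid len_gt0 len_le e_le (le_ij : i <= j).
pose n := block_start len j.
case: (boolP [&& ~~ low len j, i == mirror len j & i - n < k]) => [|unmatched].
  case/and3P=> hj /eqP im lt_k.
  rewrite -[leqRHS](size_iota 0) -(size_map (matched n)).
  apply: card_fset_set_le => // -[[|i'] [|j']] /= [] // _ [] // le_ij' eq_s'.
  have match_pair j0 : ~~ low len j0 -> block_start len j0 = n ->
      mirror len j0 - n < k ->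
      ((mirror len j0).+1, j0.+1) \in [seq matched n t | t <- iota 0 k].
    move=> hj0 sj0 lt0; apply/mapP; exists (mirror len j0 - n).
      by rewrite mem_iota.
    have := mirror_bounds len_gt0 hj0; have := block_start_bounds len_gt0 j0.
    by move: hj0; rewrite /matched /low /mirror sj0 => *; congr pair; lia.
  have [[<- <-]|[[_ hj' sj] [_ -> ej]]] :=
    rigid i' j' le_ij' (etrans eq_s (esym eq_s')).
    by rewrite im; apply: match_pair; rewrite // -im.
  apply: match_pair => //; rewrite /n.
  by move: ej lt_k; rewrite cE /= sj /n => *; lia.
apply: leq_trans (_ : size [:: (i.+1, j.+1)] <= _) => //.
apply: card_fset_set_le => // -[[|i'] [|j']] /= [] // _ [] // le_ij' eq_s'.
have [[<- <-]|[[hj hj' sj] [im im' ej]]] :=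
  rigid i' j' le_ij' (etrans eq_s (esym eq_s')).
  by rewrite inE.
move: unmatched; rewrite hj -im eqxx -leqNgt /= => le_k.
have [bi _] := andP (mirror_bounds len_gt0 hj).
have [bi' _] := andP (mirror_bounds len_gt0 hj').
have eq_i : i = i' by move: ej le_k; rewrite cE /= /n im im' -sj; lia.
have -> : j' = j by apply/esym/(mirror_inj len_gt0 hj hj' sj); rewrite -im -im'.
by rewrite eq_i inE.
Qed.

(** The mirror pairs without noise of a long enough block. *)
Lemma repr_count_ge k n : block_start len n = n -> k <= len n ->
    (forall t, t < k -> shift c t = 0) ->
  k <= repr_count enum_term (8 ^ (n + 2 * len n).-1).
Proof.
move=> nE le_k sh0; rewrite -[leqLHS](size_iota 0) -(size_map (matched n)).
apply: card_fset_set_ge; first exact: finite_repr enum_term_lt.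
  by rewrite map_inj_uniq ?iota_uniq // => t t' [] /addnI.
move=> p /mapP[t]; rewrite mem_iota add0n /= => lt_t ->.
have lt_len : t < len n by lia.
have [lt_ij _ _ _] := matched_pair len_gt0 nE lt_len.
split=> //; split; first by rewrite ltnS ltnW.
by apply: sum_matched => //; apply: sh0.
Qed.

End Representations.

Lemma repr_max_ge u s x : s <= x -> repr_count u s <= repr_max u x.
Proof.
by rewrite -ltnS => lt_s; apply: (leq_bigmax (Ordinal lt_s)).
Qed.

Lemma repr_lim_enum_term len c :
    (forall n, 0 < len n) -> (forall n, len n <= n.+1) ->
    (forall k, exists N, forall n, N <= n -> k <= len n) -> c <> Nfin 0 ->
  repr_lim (enum_term len c) c.
Proof.
move=> len_gt0 len_le len_infty c_neq0.
have large k : (forall t, t < k -> shift c t = 0) ->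
    exists s, forall x, s <= x -> k <= repr_max (enum_term len c) x.
  move=> sh0; have [N lenN] := len_infty k.
  have [n lt_Nn nE] := exists_block_start len_gt0 N.
  exists (8 ^ (n + 2 * len n).-1) => x le_sx.
  apply: leq_trans (repr_max_ge _ le_sx).
  by apply: repr_count_ge => //; apply: lenN; apply: ltnW.
rewrite /repr_lim /cvg_natbar; case cE: c => [k|].
- apply: cvg_near_cst.
  have [|s ge_k] := large k; first by rewrite cE /= => t; lia.
  exists s => // x /= /ge_k; rewrite cE => le_k; apply/eqP; rewrite eqn_leq.
  rewrite le_k andbT; apply/bigmax_leqP => i _.
  by apply: repr_count_le => //; rewrite -cE.
- apply/cvgnyPge => k; have [|s ge_k] := large k; first by rewrite cE.
  by exists s => // x /= /ge_k; rewrite cE.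
Qed.

(** Corresponding low terms agree, and corresponding high terms differ by the
    difference of two noises, each at most the offset in the block. *)
Lemma enum_term_dist len c c' n :
    (forall n, 0 < len n) -> (forall n, len n <= n.+1) ->
    c <> Nfin 0 -> c' <> Nfin 0 ->
  `|enum_term len c n - enum_term len c' n| <= (len (block_start len n.-1)).-1.
Proof.
move=> len_gt0 len_le c0 c'0; rewrite /enum_term; set j := n.-1.
case: (boolP (low len j)) => hj; first by rewrite !term_low //; lia.
have := term_high (shift c) len_gt0 hj; have := term_high (shift c') len_gt0 hj.
have := mirror_bounds len_gt0 hj.
have := shift_le (mirror len j - block_start len j) c0.
have := shift_le (mirror len j - block_start len j) c'0.
by lia.
Qed.

Lemma increasing_enum_range u : (forall i j, 0 < i -> i < j -> u i < u j) ->
  let A := u @` [set i | 0 < i] in infinite_set A /\ increasing_enum A u.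
Proof.
move=> u_lt A; split; last by [].
have uS_inj : injective (u \o succn).
  move=> i j /=; case: (ltngtP i j) => [lt_ij|lt_ji|//] eq_u.
  - by have := u_lt i.+1 j.+1 isT lt_ij; rewrite eq_u ltnn.
  - by have := u_lt j.+1 i.+1 isT lt_ji; rewrite eq_u ltnn.
move=> /(finite_preimage (in2W uS_inj)) fin; apply: infinite_nat.
by apply: sub_finite_set fin => i _; exists i.+1.
Qed.

Theorem theorem5 (a : nat) (b : natbar) (f : nat -> nat)
    (ha : 0 < a)
    (hb : b <> Nfin 0)
    (hf_mono : forall m n, 0 < m -> m <= n -> f m <= f n)
    (hf_infty : f n @[n --> \oo] --> \oo) :
  (exists (A B : set nat) (u v : nat -> nat),
      infinite_set A /\ infinite_set B /\
      increasing_enum A u /\ increasing_enum B v /\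
      repr_lim u (Nfin a) /\ repr_lim v b /\
      (forall n, 0 < n -> `|u n - v n| <= f n)) /\
  (forall (A B : set nat) (u v : nat -> nat),
      infinite_set A -> infinite_set B ->
      increasing_enum A u -> increasing_enum B v ->
      (forall n, 0 < n -> `|u n - v n| <= f n) ->
      forall n, 0 < n -> enum_dist u v n.-1 <= f n).
Proof.
split; last first.
  by move=> A B u v _ _ [u_lt _] [v_lt _]; apply: enum_dist_le.
(* The successor makes every block nonempty, even where [f] vanishes. *)
pose len n := (minn (f n.+1) n).+1.
have len_gt0 n : 0 < len n by [].
have len_le n : len n <= n.+1 by rewrite ltnS geq_minr.
have len_infty k : exists N, forall n, N <= n -> k <= len n.
  have [N _ geN] := (cvgnyPge _).1 hf_infty k.
  exists (maxn N k) => n; rewrite geq_max => /andP[leNn lekn].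
  have le_fn : k <= f n.+1 by apply: geN => /=; apply: leqW.
  by rewrite /len; lia.
have a0 : Nfin a <> Nfin 0 by case=> a0; rewrite a0 in ha.
pose u := enum_term len (Nfin a); pose v := enum_term len b.
have [infA enumA] := increasing_enum_range (enum_term_lt len_gt0 len_le a0).
have [infB enumB] := increasing_enum_range (enum_term_lt len_gt0 len_le hb).
exists (u @` [set i | 0 < i]), (v @` [set i | 0 < i]), u, v.
do 6 (split; first by [exact: infA|exact: infB|exact: enumA|exact: enumB
                      |exact: repr_lim_enum_term]).
move=> n n_gt0; apply: leq_trans (enum_term_dist _ len_gt0 len_le a0 hb) _.
case/andP: (block_start_bounds len_gt0 n.-1).
move: (block_start len n.-1) => m le_mn _; rewrite /len /=.
apply: leq_trans (geq_minl _ _) _.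
by apply: hf_mono => //; lia.
Qed.
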